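(* Let $0<q<1$. Let $P_n(x)$ be the monic $n$th-degree $q$-orthogonal polynomial with respect to the admissible weight $w(x)$ on $[-1,0)\cup(0,1]$, i.e. $$\int_{-1}^{1}P_n(x)P_m(x)w(x)\,d_qx=\gamma_n\delta_{n,m}.$$ Denote the zeros of $P_n(x)$ by $\{x_{i,n}\}_{i=1}^n$. Let $a_n,b_n$ be the recurrence coefficients in $$xP_n(x)=P_{n+1}(x)+b_nP_n(x)+a_nP_{n-1}(x),\qquad P_{-1}=0,\ P_0=1,$$ and suppose that they decay sufficiently fast such that $$\sum_{n=0}^\infty\bigl(|a_n|+|b_n|\bigr)<\infty .$$ Then, for any $k\in\mathbb N$, there exists $1\le i\le n$ (with $i$ depending on $n$) such that $x_{i,n}\to q^k$ as $n\to\infty$.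
   Context: A positively oriented Jordan curve $\Gamma$ in $\mathbb C$ with interior $\mathcal D_-$ and exterior $\mathcal D_+$ is called appropriate if $\pm q^m\in\mathcal D_-$ for all integers $m\ge 0$ and $\pm q^m\in\mathcal D_+$ for all integers $m<0$. A function $w$ is called admissible if it is analytic in the interior $\mathcal D_-$ of an appropriate curve and $w(z)\in\mathbb R$ for $z\in\mathbb R$; it need not be positive. The Jackson integral is $\int_{-1}^{1}f(x)\,d_qx=(1-q)\sum_{k=0}^{\infty}\bigl(f(q^k)+f(-q^k)\bigr)q^k$. The recurrence coefficients are given by $a_n=\gamma_n/\gamma_{n-1}$ and $b_n=\gamma_n^{-1}\int_{-1}^1xP_n(x)^2w(x)\,d_qx$ (the coefficient $a_0$ multiplies $P_{-1}=0$).
   Formalization: The conclusion is stated for those k with w(q^k) ≠ 0; without this it is false: for the admissible weight w(x)=(1-x²)(1-x²/q²) all zeros of P_n lie in (-q²,q²), so none tends to 1 or q. *)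

(* Defs.v *)
(* MathComp-Analysis: R : realType, with R[i] (mathcomp-real-closed) as the
   complex numbers. *)
From HB Require Import structures.
From mathcomp Require Export all_boot all_order all_algebra.
From mathcomp Require Export complex.
From mathcomp Require Export all_classical all_reals all_analysis.

Set Implicit Arguments.
Unset Strict Implicit.
Unset Printing Implicit Defensive.

Export Order.TTheory GRing.Theory Num.Theory.
Export numFieldNormedType.Exports.

Global Open Scope classical_set_scope.
Global Open Scope complex_scope.
Global Open Scope ring_scope.

Section curves.
Variable R : realType.
(* The ascription selects the topology induced by the norm of R[i]. *)
Local Notation C := (R[i] : numFieldType).

Definition is_jordan_curve (c : R -> C) : Prop :=
  [/\ {within `[0, 1], continuous c},
      c 0 = c 1 &
      forall s t : R, 0 <= s < 1 -> 0 <= t < 1 -> c s = c t -> s = t].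

Definition curve_image (c : R -> C) : set C := c @` `[0, 1].

(* The complement of a Jordan curve has exactly two connected components: the
   bounded one is the interior of the curve and the unbounded one is its
   exterior. *)
Definition curve_interior (c : R -> C) : set C :=
  [set z | ~ curve_image c z /\
           bounded_set (connected_component (~` curve_image c) z)].

Definition curve_exterior (c : R -> C) : set C :=
  [set z | ~ curve_image c z /\
           ~ bounded_set (connected_component (~` curve_image c) z)].

(* theta is a continuous determination of the argument of c - z; the curve is
   positively oriented when its winding number around every interior point
   is 1. *)
Definition positively_oriented (c : R -> C) : Prop :=
  forall z : C, curve_interior c z ->
    exists theta : R -> R,
      [/\ {within `[0, 1], continuous theta},
          forall t : R, 0 <= t <= 1 ->
            c t - z = `|c t - z| * (cos (theta t) +i* sin (theta t)) &
          theta 1 = theta 0 + 2 * pi].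

Definition appropriate (q : R) (c : R -> C) : Prop :=
  [/\ is_jordan_curve c,
      positively_oriented c,
      forall m : int, 0 <= m ->
        curve_interior c (q ^ m)%:C /\ curve_interior c (- q ^ m)%:C &
      forall m : int, m < 0 ->
        curve_exterior c (q ^ m)%:C /\ curve_exterior c (- q ^ m)%:C].

(* The values of w outside the interior of the curve are irrelevant. The
   interior is open, so analyticity there is complex differentiability at
   each of its points. *)
Definition admissible (q : R) (w : C -> C) : Prop :=
  exists c : R -> C,
    [/\ appropriate q c,
        forall z : C, curve_interior c z -> derivable w z 1 &
        forall t : R, curve_interior c t%:C -> complex.Im (w t%:C) = 0].

End curves.

Section jackson.
Variable R : realType.
Local Notation C := (R[i] : numFieldType).

Definition jackson_series (q : R) (f : R -> R) : R ^nat :=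
  series (fun k : nat => (f (q ^+ k) + f (- q ^+ k)) * q ^+ k).

Definition jackson_integrable (q : R) (f : R -> R) : Prop :=
  cvgn (jackson_series q f).

Definition jackson_integral (q : R) (f : R -> R) : R :=
  (1 - q) * limn (jackson_series q f).

(* An admissible w is real on the points +-q^k, so taking the real part loses
   nothing in the Jackson integrals below. *)
Definition real_weight (w : C -> C) (t : R) : R := complex.Re (w t%:C).

(* gamma n != 0 is implicit in a_n = gamma_n / gamma_(n-1) and
   b_n = gamma_n^-1 * ...; no sign is imposed on gamma n, since w need not be
   positive. *)
Definition monic_orthogonal (q : R) (w : C -> C)
    (P : nat -> {poly R}) (gamma : nat -> R) : Prop :=
  [/\ forall n, P n \is monic /\ size (P n) = n.+1,
      forall n, gamma n != 0 &
      forall n m : nat,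
        let f := fun t : R => (P n).[t] * (P m).[t] * real_weight w t in
        jackson_integrable q f /\
        jackson_integral q f = gamma n * (n == m)%:R].

(* P_(n-1), with P_(-1) = 0. *)
Definition prev_poly (P : nat -> {poly R}) (n : nat) : {poly R} :=
  if n is m.+1 then P m else 0.

(* The value a 0 is unconstrained: it multiplies P_(-1) = 0. *)
Definition recurrence_coefficients (q : R) (w : C -> C)
    (P : nat -> {poly R}) (gamma a b : nat -> R) : Prop :=
  [/\ P 0%N = 1,
      forall n, 'X * P n = P n.+1 + b n *: P n + a n *: prev_poly P n,
      forall n, a n.+1 = gamma n.+1 / gamma n &
      forall n, b n = (gamma n)^-1 *
        jackson_integral q (fun t : R => t * (P n).[t] ^+ 2 * real_weight w t)].

(* x i n, for 1 <= i <= n, are the zeros of P n with multiplicity. They are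
   complex in general, as w need not be positive. *)
Definition zeros_of (P : nat -> {poly R}) (x : nat -> nat -> C) : Prop :=
  forall n, map_poly (real_complex R) (P n) =
            \prod_(1 <= i < n.+1) ('X - (x i n)%:P).

End jackson.

(* Main.v *)
Require Import Defs.
From mathcomp Require Import zify ring lra.

(* Put c = q^k. The recurrence gives |P_n(t)| <= M c^n for |t| <= c, with M
   independent of n because the coefficients are summable. Testing P_n against
   t^m times the polynomial that vanishes at the nodes +-q^j with j <= k other
   than c, orthogonality isolates the node c and yields
   P_n(c) / c^n = O(q^n).

   On the other hand P_n is the characteristic polynomial of a balanced Jacobi
   matrix J, so by Schur's inequality its zeros satisfy
   sum |x_i|^2 <= ||J||_HS^2 and sum x_i = tr J, both bounded in n. If every
   zero stayed at distance at least e from c, then each factor of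
   P_n(c) / c^n = prod (1 - x_i / c) would have square modulus at least
   exp(- 2 Re (x_i / c) - K |x_i / c|^2), and the product would be bounded away
   from 0. This replaces the limiting entire function and Hurwitz's theorem. *)

Set Implicit Arguments.
Unset Strict Implicit.
Unset Printing Implicit Defensive.

Local Open Scope sesquilinear_scope.

(** * Zeros as eigenvalues: Schur's inequality and the Jacobi matrix *)

Lemma Schur_eigenvalues (C : numClosedFieldType) n (A : 'M[C]_n.+1) (s : seq C)
  :
  char_poly A = \prod_(x <- s) ('X - x%:P) ->
  \sum_(x <- s) x = \tr A /\
  \sum_(x <- s) `|x| ^+ 2 <= \sum_i \sum_j `|A i j| ^+ 2.
Proof.
move=> defA; have [P Pu trigT] := Schur A (ltn0Sn n).
set T := P *m A *m P^t*.
have {}trigT : is_trig_mx T by rewrite /T -conjymx.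
have PP : P^t* *m P = 1%:M.
  by have:= Pu; rewrite -trmxC_unitary => /unitarymxP; rewrite trmxCK.
have frob (B : 'M[C]_n.+1) : \sum_i \sum_j `|B i j| ^+ 2 = \tr (B *m B^t*).
  apply: eq_bigr => i _; rewrite mxE; apply: eq_bigr => j _.
  by rewrite !mxE normCK.
have defT : char_poly T = char_poly A.
  rewrite /char_poly /char_poly_mx.
  have -> : 'X%:M - map_mx polyC T =
    map_mx polyC P *m ('X%:M - map_mx polyC A) *m map_mx polyC (P^t*).
    rewrite mulmxBr mulmxBl /T !map_mxM; congr (_ - _).
    by rewrite scalar_mxC -mulmxA -map_mxM (unitarymxP _) // map_mx1 mulmx1.
  rewrite -mulmxA det_mulmx mulrC -det_mulmx -mulmxA -map_mxM PP map_mx1.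
  by rewrite mulmx1.
(* Two factorizations of one polynomial into linear factors agree up to order, and that of
   [char_poly T] is read off the diagonal. *)
have perm_s : perm_eq s [seq T i i | i <- index_enum (ordinal n.+1)].
  by apply: prod_XsubC_eq; rewrite -defA -defT char_poly_trig // big_map.
rewrite !(perm_big _ perm_s) /= !big_map /=; split.
  by rewrite -[LHS]/(\tr T) /T -mulmxA mxtrace_mulC -mulmxA PP mulmx1.
have -> : \sum_i \sum_j `|A i j| ^+ 2 = \sum_i \sum_j `|T i j| ^+ 2.
  rewrite !frob /T !trmx_mul !map_mxM trmxCK !mulmxA.
  rewrite -[_ *m P^t* *m P]mulmxA PP mulmx1.
  by rewrite [RHS]mxtrace_mulC !mulmxA PP mul1mx.
by apply: ler_sum => i _; rewrite (bigD1 i) //= lerDl sumr_ge0.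
Qed.

Local Close Scope sesquilinear_scope.

(* The recurrence matrix, conjugated by a diagonal matrix so that its two
   off-diagonals have the same modulus sqrt |a_j|; the unbalanced one, with
   off-diagonals 1 and a_j, would not be Hilbert-Schmidt uniformly in n. *)
Definition jacobi_mx (R : realType) (a b : nat -> R) n : 'M[R]_n :=
  \matrix_(i, j) (b i *+ (j == i :> nat) + Num.sqrt `|a j| *+ (j == i.+1 :> nat)
                  + a i / Num.sqrt `|a i| *+ (i == j.+1 :> nat)).

Lemma sum_ord_mulrb (V : nmodType) n (F : nat -> V) m :
  \sum_(j < n) F j *+ (j == m :> nat) = F m *+ (m < n)%N.
Proof.
case: ltnP => m_n; last first.
  by rewrite big1 // => j _; rewrite ltn_eqF // (leq_trans (ltn_ord j)).
rewrite (bigD1 (Ordinal m_n)) //= eqxx big1 ?addr0 // => j.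
by rewrite -val_eqE => /negPf /= ->.
Qed.

(** Up to a diagonal rescaling, the recurrence says that the vector of the [P j] is an eigenvector
    of [J] for the eigenvalue X, except that the last row leaves a multiple of [P n.+1]. *)
Lemma char_poly_jacobi (R : realType) (P : nat -> {poly R}) (a b : nat -> R) n :
  (forall n, P n \is monic /\ size (P n) = n.+1) -> P 0%N = 1 ->
  (forall n, 'X * P n = P n.+1 + b n *: P n + a n *: prev_poly P n) ->
  (forall n, a n.+1 != 0) ->
  char_poly (jacobi_mx a b n.+1) = P n.+1.
Proof.
move=> monP P0 recP a_neq0; set J := jacobi_mx a b n.+1.
pose r i := Num.sqrt `|a i|.
have r_neq0 i : r i.+1 != 0 by rewrite sqrtr_eq0 -ltNge normr_gt0.
(* The conjugating diagonal: [r i.+1 * d i.+1 = d i] turns the balanced off-diagonals back into the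
   coefficients 1 and [a i]. *)
pose d j := \prod_(i < j) (r i.+1)^-1.
have dS j : d j.+1 = d j / r j.+1 by rewrite /d big_ord_recr.
pose v : 'cV_n.+1 := \col_j (d j *: P j).
have Jv : char_poly_mx J *m v = \col_i ((d n *: P n.+1) *+ (i == n :> nat)).
  apply/colP => i; rewrite !mxE.
  under eq_bigr => j _ do rewrite !mxE mulrBl.
  rewrite sumrB (bigD1 i) //= eqxx big1 ?addr0; last first.
    by move=> j /negPf; rewrite eq_sym => ->; rewrite mul0r.
  have -> : \sum_(j < n.+1) (b i *+ (j == i :> nat) +
      Num.sqrt `|a j| *+ (j == i.+1 :> nat)
      + a i / Num.sqrt `|a i| *+ (i == j.+1 :> nat))%:P * (d j *: P j) =
    \sum_(j < n.+1) (b i * d j) *: P j *+ (j == i :> nat) +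
    \sum_(j < n.+1) (r j * d j) *: P j *+ (j == i.+1 :> nat) +
    \sum_(j < n.+1) (a i / r i * d j) *: P j *+ (i == j.+1 :> nat).
    rewrite -!big_split; apply: eq_bigr => j _ /=.
    by rewrite mul_polyC !scalerA !mulrDl !scalerDl !mulrnAl !scalerMnl.
  rewrite !(sum_ord_mulrb _ (fun j => (_ * d j) *: P j)).
  rewrite (sum_ord_mulrb _ (fun j => (r j * d j) *: P j)).
  have -> : \sum_(j < n.+1) (a i / r i * d j) *: P j *+ (i == j.+1 :> nat) =
            (d i * a i) *: prev_poly P i.
    case: i => -[|i] lti /=; first by rewrite scaler0 big1.
    under eq_bigr => j _ do rewrite eqSS eq_sym.
    rewrite (sum_ord_mulrb _ (fun j => (_ * d j) *: P j)) (ltnW lti) mulr1n dS.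
    by congr (_ *: _); rewrite mulrC mulrA [RHS]mulrAC.
  rewrite mulr1n -scalerAr recP !scalerDr !scalerA ltn_ord mulr1n.
  have -> : r i.+1 * d i.+1 = d i by rewrite dS mulrC divfK.
  rewrite [b i * d i]mulrC ltnS.
  have [->|i_n] := eqVneq (i : nat) n.
    by rewrite ltnn mulr0n mulr1n addr0 -[X in X - _]addrA addrK.
  have -> : (i < n)%N by rewrite ltn_neqAle i_n -ltnS ltn_ord.
  by rewrite mulr1n mulr0n [_ *: P i + _ *: P i.+1]addrC subrr.
(* The first entry of v is 1, so applying the adjugate of X - J to Jv exhibits
   char_poly J as a multiple of P_(n+1); both are monic of degree n + 1. *)
have dvd : P n.+1 %| char_poly J.
  have := congr1 (fun M => (\adj (char_poly_mx J) *m M) ord0 ord0) Jv.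
  rewrite mulmxA mul_adj_mx mul_scalar_mx !mxE /d big_ord0 scale1r P0 mulr1.
  rewrite -/(char_poly J) => ->; apply: (big_ind (fun p => P n.+1 %| p)) =>
    [|p s|i _].
  - exact: dvdp0.
  - exact: dvdp_add.
  - rewrite dvdp_mull // mxE; case: (i == n :> nat); last exact: dvdp0.
    by rewrite mulr1n dvdpZr ?dvdpp // prodf_seq_neq0; apply/allP => ? ?;
      rewrite invr_neq0.
apply/eqP; rewrite eq_sym -eqp_monic ?char_poly_monic ?(monP _).1 //.
by rewrite -dvdp_size_eqp // size_char_poly (monP _).2.
Qed.

(** * Lower bounds for products of factors 1 - z *)

(** The squared modulus taken in [R] instead of [R[i]], so that it compares directly with values of
    [expR]. *)
Definition sqnorm (R : rcfType) (z : R[i]) : R :=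
  complex.Re z ^+ 2 + complex.Im z ^+ 2.

Lemma sqnorm_ge0 (R : rcfType) (z : R[i]) : 0 <= sqnorm z.
Proof. by rewrite addr_ge0 ?sqr_ge0. Qed.

Lemma sqnormM (R : rcfType) : {morph @sqnorm R : z t / z * t}.
Proof. by move=> [u v] [s t]; rewrite /sqnorm /=; ring. Qed.

Lemma sqnormE (R : rcfType) (z : R[i]) : (sqnorm z)%:C = `|z| ^+ 2.
Proof. exact: add_Re2_Im2. Qed.

Lemma complex_ReD (R : rcfType) : {morph @complex.Re R : z t / z + t}.
Proof. by move=> [u v] [s t]. Qed.

Lemma sqnorm_real (R : rcfType) (t : R) : sqnorm t%:C = t ^+ 2.
Proof. by rewrite /sqnorm /= expr0n addr0. Qed.

(* With y = |1 - z|^2, the bound ln y >= 1 - 1/y gives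
   ln y >= (y - 1) - (y - 1)^2 / e, and y - 1 = - 2 Re z + |z|^2. *)
Lemma sqnorm1B_ge (R : realType) (z : R[i]) (e B : R) :
  0 < e -> e <= sqnorm (1 - z) -> sqnorm z <= B ->
  expR (- 2 * complex.Re z - (8 + 2 * B) / e * sqnorm z) <= sqnorm (1 - z).
Proof.
move=> e_gt0 le_e le_B.
set y := sqnorm (1 - z) in le_e *.
have y_gt0 : 0 < y := lt_le_trans e_gt0 le_e.
have [s_def z_ge0 reB] : [/\ y - 1 = - 2 * complex.Re z + sqnorm z,
    0 <= sqnorm z & complex.Re z ^+ 2 <= sqnorm z].
  split; [by rewrite /y; case: (z) => u v; rewrite /sqnorm /=; ring
         |exact: sqnorm_ge0|by rewrite lerDl sqr_ge0].
(* The constant is 2 (4 + B), from (u + v)^2 <= 2 (u^2 + v^2), (Re z)^2 <= |z|^2 and |z|^4 <= B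
   |z|^2. *)
have s2_le : (y - 1) ^+ 2 <= (8 + 2 * B) * sqnorm z.
  have : sqnorm z ^+ 2 <= B * sqnorm z by rewrite expr2 ler_wpM2r.
  have : (y - 1) ^+ 2 <= 2 * (4 * complex.Re z ^+ 2 + sqnorm z ^+ 2).
    rewrite s_def -subr_ge0.
    have -> : 2 * (4 * complex.Re z ^+ 2 + sqnorm z ^+ 2) -
      (- 2 * complex.Re z + sqnorm z) ^+ 2 = (2 * complex.Re z + sqnorm z) ^+ 2.
      ring.
    exact: sqr_ge0.
  lra.
rewrite -[leRHS]invrK -[leLHS]invrK lef_pV2 ?posrE ?invr_gt0 ?expR_gt0 //.
rewrite -expRN (le_trans _ (expR_ge1Dx _)) //.
have -> : y^-1 = 1 - (y - 1) + (y - 1) ^+ 2 / y by field; rewrite gt_eqF.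
have : (y - 1) ^+ 2 / y <= (8 + 2 * B) / e * sqnorm z.
  rewrite [leRHS]mulrAC; apply: ler_pM => //;
    rewrite ?sqr_ge0 ?invr_ge0 ?(ltW y_gt0) //.
  by rewrite lef_pV2 ?posrE.
move: (_ ^+ 2 / y) (_ / e * _) => u v; lra.
Qed.

(** The exponents of the factorwise bounds add up, so the number of factors does not enter the
    estimate. *)
Lemma sqnorm_prod1B_ge (R : realType) (s : seq R[i]) (e B : R) :
  0 < e -> (forall z, z \in s -> e <= sqnorm (1 - z)) ->
  \sum_(z <- s) sqnorm z <= B ->
  expR (- 2 * complex.Re (\sum_(z <- s) z) - (8 + 2 * B) / e * B)
    <= sqnorm (\prod_(z <- s) (1 - z)).
Proof.
move=> e_gt0 s_ge sB.
have B_ge0 : 0 <= B by apply: le_trans sB; apply: sumr_ge0 => z _;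
  apply: sqnorm_ge0.
have K_ge0 : 0 <= (8 + 2 * B) / e by rewrite divr_ge0 ?(ltW e_gt0) //; lra.
have zB z : z \in s -> sqnorm z <= B.
  move=> zs; apply: le_trans sB; rewrite (big_rem z) //= lerDl.
  by apply: sumr_ge0 => t _; apply: sqnorm_ge0.
(* The exponent becomes additive for the induction once the last [B] is replaced by the sum itself;
   the constant keeps [B], which bounds each single |z|^2. *)
apply: (@le_trans _ _
   (expR (- 2 * complex.Re (\sum_(z <- s) z) - (8 + 2 * B) / e * \sum_(z <- s)
     sqnorm z))).
  by rewrite ler_expR lerD2l lerN2 ler_wpM2l.
set K := _ / e in K_ge0 *; elim: s s_ge zB {sB} => [|z s IH] s_ge zB.
  by rewrite !big_nil /= mulr0 mulr0 subr0 expR0 sqnorm_real expr1n.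
rewrite !big_cons complex_ReD (mulrDr (- 2)) (mulrDr K (sqnorm z)).
rewrite (opprD (K * _)) addrACA expRD sqnormM.
apply: ler_pM; rewrite ?expR_ge0 //.
  by apply: sqnorm1B_ge => //; [apply: s_ge|apply: zB]; rewrite mem_head.
by apply: IH => t ts; [apply: s_ge|apply: zB]; rewrite in_cons ts orbT.
Qed.

(** * Lower bound for P_n(c) / c^n when all zeros avoid c *)

Lemma sqr_jacobi_mx (R : realType) (a b : nat -> R) n (i j : 'I_n) :
  jacobi_mx a b n i j ^+ 2 = b i ^+ 2 *+ (j == i :> nat)
    + `|a j| *+ (j == i.+1 :> nat) + `|a i| *+ (i == j.+1 :> nat).
Proof.
(* At [t = 0] the quotient is 0 by convention, in agreement with the right-hand side. *)
have sq t : (t / Num.sqrt `|t|) ^+ 2 = `|t| :> R.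
  rewrite expr_div_n sqr_sqrtr // -real_normK ?num_real //.
  by have [->|t0] := eqVneq t 0; rewrite ?normr0 ?expr0n ?mul0r // expr2 mulfK
    ?normr_eq0.
rewrite !mxE; case: (ltngtP j i) => [ji|ij|->].
- rewrite (ltn_eqF (ltnW ji : (j < i.+1)%N)) !mulr0n !add0r.
  by case: eqP; rewrite ?mulr1n ?mulr0n ?expr0n.
- rewrite (ltn_eqF (ltnW ij : (i < j.+1)%N)) !mulr0n !add0r !addr0.
  by case: eqP; rewrite ?mulr1n ?mulr0n ?expr0n // sqr_sqrtr.
- by rewrite !ltn_eqF // !mulr0n !addr0.
Qed.

(** Since |b_i| <= S, the diagonal contributes at most S * S; each off-diagonal contributes at most
    the sum of the |a_i|. *)
Lemma sum_sqr_jacobi_mx_le (R : realType) (a b : nat -> R) (S : R) n :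
  (forall n, \sum_(i < n) (`|a i| + `|b i|) <= S) ->
  \sum_i \sum_j jacobi_mx a b n i j ^+ 2 <= S * S + S + S.
Proof.
move=> abS.
have bS i : `|b i| <= S.
  apply: le_trans (abS i.+1); rewrite big_ord_recr /= addrA lerDr.
  by rewrite addr_ge0 //; apply: sumr_ge0 => j _; rewrite addr_ge0.
have S_ge0 : 0 <= S := le_trans (normr_ge0 _) (bS 0%N).
have sbS m : \sum_(i < m) `|b i| <= S.
  by apply: le_trans (abS m); apply: ler_sum => i _; rewrite lerDr.
have saS m : \sum_(i < m) `|a i| <= S.
  by apply: le_trans (abS m); apply: ler_sum => i _; rewrite lerDl.
have -> : \sum_(i < n) \sum_j jacobi_mx a b n i j ^+ 2 =
    \sum_(i < n) (b i ^+ 2 + `|a i.+1| *+ (i.+1 < n)%N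
                  + \sum_(j < n) `|a i| *+ (i == j.+1 :> nat)).
  apply: eq_bigr => i _; under eq_bigr do rewrite sqr_jacobi_mx.
  rewrite !big_split /= (sum_ord_mulrb _ (fun=> b i ^+ 2)) ltn_ord mulr1n.
  by rewrite (sum_ord_mulrb _ (fun j => `|a j|)).
rewrite !big_split /= !lerD //.
- apply: (@le_trans _ _ (\sum_(i < n) S * `|b i|)).
    by apply: ler_sum => i _; rewrite -real_normK ?num_real // expr2 ler_wpM2r.
  by rewrite -mulr_sumr ler_wpM2l.
- apply: le_trans (saS n.+1); rewrite big_ord_recl -[leLHS]add0r lerD //.
  by apply: ler_sum => i _; rewrite lift0; case: (_ < n)%N;
    rewrite ?mulr1n ?mulr0n.
- apply: le_trans (saS n); apply: ler_sum => -[[|i] lti] _ /=.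
    by rewrite big1.
  under eq_bigr => j _ do rewrite eqSS eq_sym.
  by rewrite (sum_ord_mulrb _ (fun=> `|a i.+1|)); case: (i < n)%N;
    rewrite ?mulr1n ?mulr0n.
Qed.

Lemma mxtrace_jacobi_mx (R : realType) (a b : nat -> R) n :
  \tr (jacobi_mx a b n) = \sum_(i < n) b i.
Proof.
by apply: eq_bigr => i _; rewrite mxE eqxx !(ltn_eqF (ltnSn i)) !mulr0n !addr0.
Qed.

(** Dividing the zeros by [c] turns the quotient into a product of factors 1 - z; the trace and the
    Hilbert-Schmidt norm of the Jacobi matrix control the sums of z and |z|^2 uniformly in n. *)
Lemma orthogonal_poly_lower_bound (R : realType) (P : nat -> {poly R})
    (a b : nat -> R) (S c e : R) :
  (forall n, P n \is monic /\ size (P n) = n.+1) -> P 0%N = 1 ->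
  (forall n, 'X * P n = P n.+1 + b n *: P n + a n *: prev_poly P n) ->
  (forall n, a n.+1 != 0) ->
  (forall n, \sum_(i < n) (`|a i| + `|b i|) <= S) ->
  0 < c -> 0 < e ->
  exists2 K, 0 < K & forall n (s : seq R[i]),
    map_poly (real_complex R) (P n.+1) = \prod_(x <- s) ('X - x%:P) ->
    (forall x, x \in s -> e <= sqnorm (c%:C - x)) ->
    K <= ((P n.+1).[c] / c ^+ n.+1) ^+ 2.
Proof.
move=> monP P0 recP a_neq0 abS c_gt0 e_gt0.
have c_neq0 := lt0r_neq0 c_gt0.
have cC_neq0 : c%:C != 0 by rewrite fmorph_eq0.
(* [B] bounds the sum of the |x / c|^2 over the zeros x, and [d] bounds each |1 - x / c|^2 from
   below. *)
pose B := (S * S + S + S) / c ^+ 2; pose d := e / c ^+ 2.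
exists (expR (- 2 * (S / c) - (8 + 2 * B) / d * B)); first exact: expR_gt0.
move=> n s Ps far.
have size_s : size s = n.+1.
  have := congr1 (fun p : {poly R[i]} => size p) Ps.
  by rewrite /= size_prod_XsubC size_map_poly (monP _).2 => -[].
have charC : char_poly (map_mx (real_complex R) (jacobi_mx a b n.+1)) =
    \prod_(x <- s) ('X - x%:P).
  by rewrite -map_char_poly (char_poly_jacobi _ monP P0 recP a_neq0).
have [sum_s sum_s2] := Schur_eigenvalues charC.
pose zs := [seq x / c%:C | x <- s].
have sumz : complex.Re (\sum_(z <- zs) z) = (\sum_(i < n.+1) b i) / c.
  rewrite big_map -mulr_suml sum_s trace_map_mx mxtrace_jacobi_mx.
  by rewrite -(fmorphV (real_complex R)) -(rmorphM (real_complex R)).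
have sumz2 : \sum_(z <- zs) sqnorm z <= B.
  rewrite big_map; under eq_bigr => x _ do rewrite sqnormM -(fmorphV
    (real_complex R)) sqnorm_real.
  rewrite -mulr_suml exprVn ler_pM2r ?invr_gt0 ?exprn_gt0 //.
  apply: le_trans (sum_sqr_jacobi_mx_le n.+1 abS).
  rewrite -lecR rmorph_sum /=; under eq_bigr => x _ do rewrite sqnormE.
  apply: le_trans sum_s2 _; rewrite rmorph_sum /=.
  apply: ler_sum => i _; rewrite rmorph_sum /=; apply: ler_sum => j _.
  by rewrite mxE -sqnormE sqnorm_real.
have oneB x : 1 - x / c%:C = (c%:C - x) / c%:C by rewrite mulrBl divff.
have -> : ((P n.+1).[c] / c ^+ n.+1) ^+ 2 = sqnorm (\prod_(z <- zs) (1 - z)).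
  rewrite -sqnorm_real big_map; congr sqnorm.
  under eq_bigr => x _ do rewrite oneB.
  rewrite big_split /= big_const_seq count_predT size_s.
  rewrite rmorphM fmorphV rmorphXn /= -horner_map Ps horner_prod.
  congr (_ * _); first by apply: eq_bigr => x _; rewrite !hornerE.
  by rewrite iter_mulr_1 -exprS exprVn.
apply: le_trans (sqnorm_prod1B_ge (e := d) _ _ sumz2); last 2 first.
- by rewrite divr_gt0 ?exprn_gt0.
- move=> z /mapP[x xs ->]; rewrite oneB sqnormM -(fmorphV (real_complex R))
  sqnorm_real exprVn.
  by rewrite ler_pM2r ?invr_gt0 ?exprn_gt0 ?far.
rewrite ler_expR lerD2r sumz !mulNr lerN2 ler_pM2l // ler_pM2r ?invr_gt0 //.
apply: le_trans (abS n.+1); apply: ler_sum => i _.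
by rewrite (le_trans (ler_norm _)) // lerDr.
Qed.

(** * Orthogonality and the size of the weight at the nodes *)

(** The series sums to 0 and starts at index k, so [u k] is minus its tail, which a geometric series
    dominates. *)
Lemma isolated_term_le (R : realType) (u : R ^nat) (q A : R) k :
  0 < q < 1 -> 0 <= A -> series u @ \oo --> (0 : R) ->
  (forall j, (j < k)%N -> u j = 0) ->
  (forall j, (k < j)%N -> `|u j| <= A * q ^+ j) ->
  `|u k| <= A / (1 - q).
Proof.
move=> /andP[q_gt0 q_lt1] A_ge0 u_cvg u_lt u_gt.
(* The supposed excess of [|u k|] over the bound serves as epsilon for the partial sums. *)
rewrite leNgt; apply/negP => /[dup] lt_u; rewrite -subr_gt0 => e_gt0.
have q1_gt0 : 0 < 1 - q by rewrite subr_gt0.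
have /cvgrPdist_lt /(_ _ e_gt0) [N _] := u_cvg.
move=> /(_ (maxn N k.+1) (leq_maxl _ _)) /=.
set M := maxn N k.+1; rewrite sub0r normrN => uM.
have kM : (k < M)%N by rewrite leq_max ltnSn orbT.
suff : `|series u M - u k| <= A / (1 - q).
  have := ler_normB (series u M) (series u M - u k).
  rewrite subKr; lra.
have -> : series u M - u k = \sum_(j < M) (u j - u k *+ (j == k :> nat)).
  by rewrite sumrB (sum_ord_mulrb _ (fun=> u k)) kM mulr1n /series /= big_mkord.
apply: le_trans (ler_norm_sum _ _ _) _.
apply: (@le_trans _ _ (\sum_(j < M) A * q ^+ j)).
  apply: ler_sum => j _; case: (ltngtP j k) => [jk|kj|->].
  - by rewrite u_lt // mulr0n subr0 normr0 mulr_ge0 ?exprn_ge0 // ltW.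
  - by rewrite mulr0n subr0 u_gt.
  - by rewrite mulr1n subrr normr0 mulr_ge0 ?exprn_ge0 // ltW.
rewrite -mulr_sumr ler_wpM2l // -(ler_pM2r q1_gt0) mulVf ?gt_eqF //.
have := subrX1 q M; rewrite mulrC => qM.
have : 0 <= q ^+ M by rewrite exprn_ge0 // ltW.
by move: qM; move: (q ^+ M) (\sum_(i < M) _) => x y; lra.
Qed.

Lemma cvgn_bounded (R : realType) (u : R ^nat) :
  cvgn u -> exists C, forall n, `|u n| <= C.
Proof.
move=> /cvg_seq_bounded [C [_ /(_ (C + 1))]]; rewrite ltrDl ltr01 =>
  /(_ isT) uC.
by exists (C + 1) => n; apply: uC.
Qed.

Lemma poly_bounded_unit (R : realType) (p : {poly R}) :
  exists2 G, 0 <= G & forall t, `|t| <= 1 -> `|p.[t]| <= G.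
Proof.
exists (\sum_(i < size p) `|p`_i|); first exact: sumr_ge0.
move=> t t1; rewrite horner_coef; apply: le_trans (ler_norm_sum _ _ _) _.
by apply: ler_sum => i _; rewrite normrM normrX ler_piMr // exprn_ile1.
Qed.

Lemma jackson_seriesD (R : realType) (q s : R) (f g : R -> R) :
  jackson_series q (fun t => f t + s * g t) =
  jackson_series q f + s *: jackson_series q g.
Proof.
apply/funext => n; rewrite /jackson_series /series /= !fctE /=.
rewrite scaler_sumr -big_split; apply: eq_bigr => j _ /=.
by rewrite /GRing.scale /=; ring.
Qed.

(** Induction on the degree, removing the leading term by a multiple of [P m]. Convergence is part
    of the conclusion because [limn] of a divergent series is a mere default value. *)
Lemma orthogonal_lower_degree (R : realType) (q : R)
    (w : (R[i] : numFieldType) -> (R[i] : numFieldType))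
    (P : nat -> {poly R}) (gamma : nat -> R) n (g : {poly R}) :
  q < 1 -> monic_orthogonal q w P gamma -> (size g <= n)%N ->
  jackson_series q (fun t => (P n).[t] * g.[t] * real_weight w t) @ \oo
    --> (0 : R).
Proof.
move=> q_lt1 [monP _ orth].
suff H m (h : {poly R}) : (m <= n)%N -> (size h <= m)%N ->
    jackson_series q (fun t => (P n).[t] * h.[t] * real_weight w t) @ \oo
    --> (0 : R) by exact: H.
elim: m h => [|m IH] h mn.
  rewrite leqn0 size_poly_eq0 => /eqP ->.
  rewrite (_ : jackson_series _ _ = cst 0); first exact: cvg_cst.
  apply/funext => N; rewrite /jackson_series /series /= big1 // => j _.
  by rewrite !horner0 !mulr0 !mul0r addr0 mul0r.
move=> size_h; pose h' := h - h`_m *: P m.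
have size_h' : (size h' <= m)%N.
  apply/leq_sizeP => j; rewrite leq_eqVlt => /predU1P[<-|mj].
    have := monicP (monP m).1; rewrite lead_coefE (monP m).2 /= => Pm.
    by rewrite coefB coefZ Pm mulr1 subrr.
  rewrite coefB coefZ [h`_j]nth_default ?(leq_trans size_h) //.
  by rewrite [(P m)`_j]nth_default ?(monP m).2 // mulr0 subrr.
have [int_m eq_m] := orth n m.
have Pm_cvg : jackson_series q
    (fun t => (P n).[t] * (P m).[t] * real_weight w t) @ \oo --> (0 : R).
  move: eq_m; rewrite gtn_eqF // mulr0 => /eqP.
  by rewrite mulf_eq0 subr_eq0 gt_eqF //= => /eqP <-.
have -> : (fun t => (P n).[t] * h.[t] * real_weight w t) =
    (fun t => (P n).[t] * h'.[t] * real_weight w t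
       + h`_m * ((P n).[t] * (P m).[t] * real_weight w t)).
  apply/funext => t; rewrite /h' hornerD hornerN hornerZ; ring.
rewrite jackson_seriesD.
have := cvgD (IH _ (ltnW mn) size_h') (cvgZl_tmp (k := h`_m) Pm_cvg).
by rewrite scaler0 addr0 => H; apply: H.
Qed.

(* w need not be bounded near 0, since 0 may lie on the curve. The moments of
   order 0 and 1 only control w(q^j) + w(-q^j) and q^j (w(q^j) - w(-q^j)),
   whence the factor q^(2j). *)
Lemma real_weight_bounded (R : realType) (q : R)
    (w : (R[i] : numFieldType) -> (R[i] : numFieldType))
    (P : nat -> {poly R}) (gamma a b : nat -> R) :
  0 < q < 1 -> monic_orthogonal q w P gamma ->
  recurrence_coefficients q w P gamma a b ->
  exists C, forall j, `|real_weight w (q ^+ j)| * q ^+ j ^+ 2 <= C /\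
    `|real_weight w (- q ^+ j)| * q ^+ j ^+ 2 <= C.
Proof.
move=> /andP[q_gt0 q_lt1] [monP _ orth] [P0 recP _ _].
have P1 : P 1%N = 'X - (b 0)%:P.
  by have := recP 0%N; rewrite P0 /= scaler0 addr0 mulr1 -alg_polyC => ->;
    rewrite addrK.
(* The terms of a convergent series tend to 0, hence are bounded. *)
have [C0 /= u0] := cvgn_bounded (cvgP _ (cvg_series_cvg_0 (orth 0 0)%N.1)).
have [C1 /= u1] := cvgn_bounded (cvgP _ (cvg_series_cvg_0 (orth 1 0)%N.1)).
exists (C0 + C1 + `|b 0| * C0) => j; move: (u0 j) (u1 j).
rewrite P0 P1 !hornerE /=.
have x_gt0 : 0 < q ^+ j by rewrite exprn_gt0.
have x_le1 : q ^+ j <= 1 by rewrite exprn_ile1 // ltW.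
move: (q ^+ j) x_gt0 x_le1 (real_weight w _) (real_weight w _) =>
  x x0 x1 v' v {}u0 {}u1.
have s_le : `|(v + v') * x ^+ 2| <= C0.
  by apply: le_trans u0; rewrite expr2 mulrA normrM ler_piMr // gtr0_norm.
have d_le : `|(v - v') * x ^+ 2| <= C1 + `|b 0| * C0.
  have -> : (v - v') * x ^+ 2 = ((x - b 0) * v + (- x - b 0) * v') * x +
     b 0 * ((v + v') * x) by ring.
  apply: le_trans (ler_normD _ _) _; rewrite lerD //.
  by rewrite normrM ler_wpM2l.
have n2 : `|x ^+ 2| = x ^+ 2 by rewrite ger0_norm // exprn_ge0 // ltW.
rewrite -!mulrA -expr2 -n2 -!normrM.
have hlf (y z : R) : `|y| <= C0 -> `|z| <= C1 + `|b 0| * C0 ->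
    `|(y + z) / 2| <= C0 + C1 + `|b 0| * C0.
  move=> yC zC; rewrite normrM (@ger0_norm _ 2^-1) //.
  move: (ler_normD y z) (normr_ge0 (y + z)); lra.
split.
  have -> : v * x ^+ 2 = ((v + v') * x ^+ 2 + (v - v') * x ^+ 2) / 2 by field.
  exact: hlf.
have -> : v' * x ^+ 2 = ((v + v') * x ^+ 2 - (v - v') * x ^+ 2) / 2 by field.
by rewrite hlf ?normrN.
Qed.

(** * Upper bound for P_n(c) / c^n *)

(** Relative to c^n, each recurrence step costs a factor 1 + |b_n| / c + |a_n| / c^2, at most the
    exponential of its last two terms, which are summable. *)
Lemma orthogonal_poly_growth (R : realType) (P : nat -> {poly R})
    (a b : nat -> R) (S c : R) :
  P 0%N = 1 ->
  (forall n, 'X * P n = P n.+1 + b n *: P n + a n *: prev_poly P n) ->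
  (forall n, \sum_(i < n) (`|a i| + `|b i|) <= S) -> 0 < c ->
  forall n t, `|t| <= c ->
    `|(P n).[t]| <= expR (S / c + S / c ^+ 2) * c ^+ n.
Proof.
move=> P0 recP abS c_gt0 n t tc; have c_neq0 := lt0r_neq0 c_gt0.
pose E n := expR (\sum_(i < n) (`|b i| / c + `|a i| / c ^+ 2)).
have E_ge m : E m <= expR (S / c + S / c ^+ 2).
  rewrite ler_expR big_split /= -!mulr_suml.
  by apply: lerD; rewrite ler_pM2r ?invr_gt0 ?exprn_gt0 //;
    apply: le_trans (abS m); apply: ler_sum => i _; rewrite ?lerDl ?lerDr.
(* The recurrence has order two, so the bound on the previous polynomial is carried along, weighted
   by [c]. *)
suff [H _] : `|(P n).[t]| <= E n * c ^+ n /\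
    `|(prev_poly P n).[t]| * c <= E n * c ^+ n.
  by apply: le_trans H _; rewrite ler_pM2r ?exprn_gt0.
elim: n => [|n [IH1 IH2]].
  rewrite P0 /E big_ord0 expR0 /= hornerC horner0 normr1 normr0 mul0r mul1r
    expr0.
  by rewrite lexx ler01.
have En_ge0 : 0 <= E n by exact: expR_ge0.
have ES : E n * (1 + (`|b n| / c + `|a n| / c ^+ 2)) <= E n.+1.
  by rewrite /E big_ord_recr /= expRD ler_wpM2l ?expR_ge0 ?expR_ge1Dx.
have E_mono : E n <= E n.+1.
  apply: le_trans ES; rewrite ler_peMr // lerDl addr_ge0 // divr_ge0 //.
    exact: ltW.
  by rewrite exprn_ge0 // ltW.
have cn_gt0 : 0 < c ^+ n.+1 by rewrite exprn_gt0.
split; last first.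
  rewrite /= (@le_trans _ _ (E n * c ^+ n * c)) ?ler_wpM2r // ?(ltW c_gt0) //.
  by rewrite -mulrA -exprSr ler_wpM2r // ltW.
have -> : (P n.+1).[t] =
    (t - b n) * (P n).[t] - a n * (prev_poly P n).[t].
  have := congr1 (fun p => p.[t]) (recP n).
  by rewrite !hornerE => H; rewrite mulrBl H; ring.
apply: (@le_trans _ _ (E n * (1 + (`|b n| / c + `|a n| / c ^+ 2)) * c ^+
  n.+1)); last first.
  by rewrite ler_wpM2r // ltW.
have -> : E n * (1 + (`|b n| / c + `|a n| / c ^+ 2)) * c ^+ n.+1 =
   (c + `|b n|) * (E n * c ^+ n) + `|a n| * (E n * c ^+ n / c).
  by rewrite [c ^+ n.+1]exprS; field.
apply: le_trans (ler_normB _ _) _; rewrite !normrM lerD //.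
  rewrite ler_pM // (le_trans (ler_normB _ _)) // lerD //.
by rewrite ler_wpM2l // ler_pdivlMr.
Qed.

(* Test P_n against the polynomial of degree n - 1 that vanishes at all the
   nodes of modulus at least q^k except q^k itself, and to high order at 0. *)
Lemma orthogonal_poly_decay (R : realType) (q : R)
    (w : (R[i] : numFieldType) -> (R[i] : numFieldType))
    (P : nat -> {poly R}) (gamma a b : nat -> R) (S : R) k :
  0 < q < 1 -> monic_orthogonal q w P gamma ->
  recurrence_coefficients q w P gamma a b ->
  (forall n, \sum_(i < n) (`|a i| + `|b i|) <= S) ->
  real_weight w (q ^+ k) != 0 ->
  exists D, forall m,
    `|(P (m + (2 * k + 4))%N).[q ^+ k] / (q ^+ k) ^+ (m + (2 * k + 4))|
      <= D * q ^+ m.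
Proof.
move=> q01 orth rec abS wk_neq0; have /andP[q_gt0 q_lt1] := q01.
have [C wC] := real_weight_bounded q01 orth rec.
have [P0 recP _ _] := rec.
set c := q ^+ k; have c_gt0 : 0 < c by rewrite exprn_gt0.
have growth := orthogonal_poly_growth P0 recP abS c_gt0.
set M := expR _ in growth; have M_gt0 : 0 < M := expR_gt0 _.
pose g0 : {poly R} := (\prod_(j < k) ('X - (q ^+ j)%:P)) *
                      \prod_(j < k.+1) ('X - (- q ^+ j)%:P).
have size_g0 : size g0 = (2 * k + 2)%N.
  rewrite size_mul ?monic_neq0 ?monic_prod_XsubC // !size_prod_XsubC.
  by rewrite /index_enum -!enumT !size_enum_ord mulSn mul1n !addnS addn0.
have g0_pos j : (j < k)%N -> g0.[q ^+ j] = 0.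
  move=> jk; rewrite hornerM horner_prod (bigD1 (Ordinal jk)) //=.
  by rewrite hornerXsubC subrr !mul0r.
have g0_neg j : (j <= k)%N -> g0.[- q ^+ j] = 0.
  move=> jk; rewrite hornerM [X in _ * X]horner_prod.
  rewrite (bigD1 (Ordinal (jk : (j < k.+1)%N))) //=.
  by rewrite hornerXsubC subrr mul0r mulr0.
have q_neq1 : q != 1 by rewrite lt_eqF.
have g0c_neq0 : g0.[c] != 0.
  rewrite hornerM !horner_prod mulf_neq0 //; apply/prodf_neq0 => j _;
    rewrite hornerXsubC.
    by rewrite subr_eq0 (inj_eq (ieexprIn q_gt0 q_neq1)) gtn_eqF.
  by rewrite opprK gt_eqF // addr_gt0 // exprn_gt0.
clearbody g0; have [G G_ge0 g0G] := poly_bounded_unit g0.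
have C_ge0 : 0 <= C.
  by apply: le_trans (wC 0%N).1; rewrite mulr_ge0 // exprn_ge0 // exprn_ge0 //
    ltW.
(* What remains of the term at [c] besides [P n] and c^m: the cube collects two powers from [g] and
   one from the Jackson weight. *)
pose K := `|g0.[c]| * c ^+ 3 * `|real_weight w c|.
have K_gt0 : 0 < K by rewrite !mulr_gt0 ?exprn_gt0 ?normr_gt0.
exists (2 * M * G * C / (1 - q) / K) => m.
(* Beyond index k, |P_n| <= M c^n, |g0| <= G and |t|^m <= (q^(k+1))^m, while [C] bounds the weight
   times t^2; the 2 counts both signs. The gain over c^m is q^m. *)
set n := (m + _)%N; set A := 2 * M * G * C * c ^+ n * (q ^+ k.+1) ^+ m.
have A_ge0 : 0 <= A.
  by rewrite !mulr_ge0 ?exprn_ge0 ?exprn_ge0 ?(ltW M_gt0) ?(ltW q_gt0) ?(ltW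
    c_gt0).
(* The degree is (2k + 1) + (m + 2) = n - 1. Two powers of X absorb the weight near 0; the other m
   produce the decay. *)
pose g := g0 * 'X^(m.+2).
have size_g : (size g <= n)%N.
  rewrite (leq_trans (size_polyMleq _ _)) // size_g0 size_polyXn /n; lia.
have gE t : g.[t] = g0.[t] * t ^+ m.+2 by rewrite hornerM hornerXn.
have := orthogonal_lower_degree q_lt1 orth size_g.
clearbody g; rewrite /jackson_series => /isolated_term_le - /(_ q A k q01
  A_ge0).
have side j : (k < j)%N -> forall e : R, (e == q ^+ j) || (e == - q ^+ j) ->
    `|real_weight w e| * q ^+ j ^+ 2 <= C ->
    `|(P n).[e] * g.[e] * real_weight w e * q ^+ j| <= A / 2 * q ^+ j.
  move=> kj e eE we.
  have qj_gt0 : 0 < q ^+ j by rewrite exprn_gt0.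
  have ne : `|e| = q ^+ j.
    by case/orP: eE => /eqP ->; rewrite ?normrN gtr0_norm.
  have qj_le : q ^+ j <= q ^+ k.+1 by rewrite ler_wiXn2l // ltW.
  have ec : `|e| <= c by rewrite ne ler_wiXn2l ?(ltW q_gt0) ?(ltW q_lt1) ?(ltnW
    kj).
  have e1 : `|e| <= 1 by rewrite ne exprn_ile1 // ltW.
  rewrite normrM [`|q ^+ j|]gtr0_norm // ler_pM2r //.
  rewrite gE normrM [`|(P n).[e] * _|]normrM (normrM g0.[e]) normrX ne.
  have -> : A / 2 = (M * c ^+ n) * (G * (q ^+ k.+1) ^+ m) * C by rewrite /A;
    field.
  have -> : `|(P n).[e]| * (`|g0.[e]| * q ^+ j ^+ m.+2) * `|real_weight w e| =
     `|(P n).[e]| * (`|g0.[e]| * q ^+ j ^+ m) * (`|real_weight w e| * q ^+ j ^+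
       2).
    by rewrite !exprS; ring.
  have qjm_ge0 : 0 <= q ^+ j ^+ m by rewrite exprn_ge0 // ltW.
  apply: ler_pM => //.
  - by rewrite !mulr_ge0.
  - by rewrite mulr_ge0 // sqr_ge0.
  apply: ler_pM; rewrite ?mulr_ge0 ?growth //.
  apply: ler_pM; rewrite ?g0G //.
  by rewrite lerXn2r ?nnegrE ?exprn_ge0 // ltW.
have u_lt j : (j < k)%N -> ((P n).[q ^+ j] * g.[q ^+ j] * real_weight w (q ^+ j)
    + (P n).[- q ^+ j] * g.[- q ^+ j] * real_weight w (- q ^+ j)) * q ^+ j = 0.
  by move=> jk; rewrite !gE (g0_pos _ jk) (g0_neg _ (ltnW jk)) !mul0r !mulr0
    !mul0r addr0 mul0r.
have u_gt j : (k < j)%N ->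
    `|((P n).[q ^+ j] * g.[q ^+ j] * real_weight w (q ^+ j)
    + (P n).[- q ^+ j] * g.[- q ^+ j] * real_weight w (- q ^+ j)) * q ^+ j|
    <= A * q ^+ j.
  move=> kj; rewrite mulrDl (_ : A * q ^+ j = A / 2 * q ^+ j + A / 2 * q ^+ j);
    last by field.
  apply: le_trans (ler_normD _ _) _; apply: lerD; apply: side => //.
  - by rewrite eqxx.
  - exact: (wC j).1.
  - by rewrite eqxx orbT.
  - exact: (wC j).2.
move=> /(_ u_lt u_gt).
rewrite [g.[- q ^+ k]]gE (g0_neg _ (leqnn k)) mul0r mulr0 mul0r addr0 -/c.
have -> : `|(P n).[c] * g.[c] * real_weight w c * c| = `|(P n).[c]| * c ^+ m *
  K.
  rewrite gE (normrM _ c) (normrM _ (real_weight w c)) (normrM (P n).[c]).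
  by rewrite (normrM g0.[c]) normrX (gtr0_norm c_gt0) /K !exprS; ring.
have cn_gt0 : 0 < c ^+ n by rewrite exprn_gt0.
have cm_gt0 : 0 < c ^+ m by rewrite exprn_gt0.
move=> le_A; rewrite normrM normfV [`|c ^+ n|]gtr0_norm //.
rewrite ler_pdivrMr // -(ler_pM2r K_gt0) -(ler_pM2r cm_gt0).
rewrite mulrAC (le_trans le_A) // /A exprS exprMn -/c.
rewrite le_eqVlt; apply/orP; left; apply/eqP; field.
by rewrite !gt_eqF // subr_gt0.
Qed.

(** * Convergence of the nearest zero *)

Lemma closest_index (R : realType) (f : nat -> R) n : (0 < n)%N ->
  exists i, (1 <= i <= n)%N /\ forall j, (1 <= j <= n)%N -> f i <= f j.
Proof.
case: n => // n _; case: (@Order.TotalTheory.arg_minP _ _ _ (@ord0 n) xpredT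
  (fun i => f i.+1)) => // i _ min_i.
exists i.+1; split; first by rewrite ltnS ltn_ord.
move=> [//|j] jn; exact: (min_i (Ordinal (jn : (j < n.+1)%N))).
Qed.

(** The node lies inside the curve, where an admissible weight is real on the real axis, so its
    value there is its real part. *)
Lemma real_weight_neq0 (R : realType) (q : R)
    (w : (R[i] : numFieldType) -> (R[i] : numFieldType)) k :
  admissible q w -> w (q ^+ k)%:C != 0 -> real_weight w (q ^+ k) != 0.
Proof.
move=> [c [[_ _ inside _] _ w_real]]; apply: contraNneq => re0.
have [ins _] := inside k%:Z isT.
have := w_real _ ins; rewrite /real_weight in re0.
move: re0; rewrite -exprnP; case: (w _) => u v /= -> ->; exact: eqxx.
Qed.

(** Convergence in [R[i]] is tested with positive complex epsilons; the order makes them real. *)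
Lemma complex_gt0 (R : rcfType) (z : R[i]) :
  0 < z -> exists2 r, 0 < r & z = r%:C.
Proof. by case: z => u v; rewrite ltcE /= => /andP[/eqP -> u_gt0];
  exists u. Qed.

Theorem theorem1p2 (R : realType) (q : R)
    (w : (R[i] : numFieldType) -> (R[i] : numFieldType))
    (P : nat -> {poly R}) (gamma a b : nat -> R)
    (x : nat -> nat -> (R[i] : numFieldType)) :
  0 < q < 1 ->
  admissible q w ->
  monic_orthogonal q w P gamma ->
  zeros_of P x ->
  recurrence_coefficients q w P gamma a b ->
  cvgn (series (fun n : nat => `|a n| + `|b n|)) ->
  forall k : nat, w (q ^+ k)%:C != 0 ->
  exists i : nat -> nat,
    (forall n : nat, (0 < n)%N -> (1 <= i n <= n)%N) /\
    (fun n : nat => x (i n) n) @ \oo --> ((q ^+ k)%:C : (R[i] : numFieldType)).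
Proof.
move=> q01 adm orth zeros rec cvg_ab k wk_neq0.
have /andP[q_gt0 q_lt1] := q01.
have [P0 recP aE _] := rec; have [monP gamma_neq0 _] := orth.
have a_neq0 n : a n.+1 != 0 by rewrite aE mulf_neq0 ?invr_neq0.
have [S abS] : exists S, forall n, \sum_(i < n) (`|a i| + `|b i|) <= S.
  have [S serS] := cvgn_bounded cvg_ab; exists S => n.
  by apply: le_trans (serS n); rewrite /series /= big_mkord ler_norm.
have [D decay] := orthogonal_poly_decay q01 orth rec abS (real_weight_neq0 adm
  wk_neq0).
set c := q ^+ k in decay *; have c_gt0 : 0 < c by rewrite exprn_gt0.
(* The index selects a zero nearest to [c]; at n = 0 there is none and the value is arbitrary. *)
have /choice [idx iP] : forall n, exists i, (0 < n)%N -> (1 <= i <= n)%N /\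
    forall j, (1 <= j <= n)%N ->
      sqnorm (c%:C - x i n) <= sqnorm (c%:C - x j n).
  move=> n; case: (posnP n) => [->|n_gt0]; first by exists 0%N.
  have [i0 i0P] := closest_index (fun i => sqnorm (c%:C - x i n)) n_gt0.
  by exists i0.
exists idx; split=> [n /iP[]//|].
apply/cvgrPdist_lt => _ /complex_gt0[e e_gt0 ->].
have [K K_gt0 lower] := orthogonal_poly_lower_bound monP P0 recP a_neq0 abS
  c_gt0 (exprn_gt0 2 e_gt0).
(* The threshold forces D^2 q^m < K; the added 1 keeps the denominator positive even for [D = 0]. *)
have [N _ smallN] : \forall m \near \oo, q ^+ m < K / (D ^+ 2 + 1).
  have D1_gt0 : 0 < K / (D ^+ 2 + 1) by rewrite divr_gt0 // ltr_wpDl ?sqr_ge0.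
  have /cvgrPdist_lt /(_ _ D1_gt0) : (fun m => q ^+ m) @ \oo --> (0 : R).
    by apply: cvg_expr; rewrite gtr0_norm.
  by apply: filterS => m /=; rewrite sub0r normrN gtr0_norm // exprn_gt0.
exists (N + (2 * k + 4))%N => // n /= le_n.
have n_gt0 : (0 < n)%N by lia.
have [_ min_i] := iP n n_gt0.
rewrite -(@ltr_pXn2r _ 2) ?nnegrE ?normr_ge0 ?ler0c ?(ltW e_gt0) //.
(* If the nearest zero is at distance at least e, so are all zeros, and the lower and upper bounds
   collide. *)
rewrite -sqnormE -rmorphXn ltcR ltNge; apply/negP => far.
pose m := (n - (2 * k + 4))%N.
have nE : n = (m + (2 * k + 4))%N by rewrite /m; lia.
have small : q ^+ m < K / (D ^+ 2 + 1) by apply: smallN; rewrite /= /m; lia.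
have lowK : K <= ((P n).[c] / c ^+ n) ^+ 2.
  move: n_gt0 min_i far (zeros n); case: (n) => // n' _ min_i far zn.
  apply: (lower n' [seq x j n'.+1 | j <- index_iota 1 n'.+2]).
    by rewrite big_map.
  move=> z /mapP[j]; rewrite mem_index_iota => /min_i le_j ->.
  exact: le_trans far le_j.
have D2 : ((P n).[c] / c ^+ n) ^+ 2 <= D ^+ 2 * q ^+ m.
  have qm_gt0 : 0 < q ^+ m by rewrite exprn_gt0.
  have qm_le1 : q ^+ m <= 1 by rewrite exprn_ile1 // ltW.
  have := decay m; rewrite -nE => dec.
  apply: (@le_trans _ _ ((D * q ^+ m) ^+ 2)).
    rewrite -real_normK ?num_real // lerXn2r ?nnegrE //.
    exact: le_trans (normr_ge0 _) dec.
  by rewrite exprMn ler_wpM2l ?sqr_ge0 // expr2 ler_piMr // ltW.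
have := le_trans lowK D2.
move: small; rewrite ltr_pdivlMr ?ltr_wpDl ?sqr_ge0 //.
have : 0 < q ^+ m by rewrite exprn_gt0.
move: (q ^+ m) (D ^+ 2) => u v; nra.
Qed.
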